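(* Let $(X,I)$ be a Polish ideal space. Suppose that a family $\mathcal{A}\subseteq I$ has the following properties: (1) for every $x\in X$, $|\mathcal{A}_x|=2^{\omega}$; (2) for all $x,y\in X$, if $x\neq y$ then $|\mathcal{A}_x\cap\mathcal{A}_y|\le\omega$; (3) $\mathrm{cov}_h(\mathcal{A})=2^{\omega}$. Then there exists a subfamily $\mathcal{A}_0\subseteq\mathcal{A}$ such that $\bigcup\mathcal{A}_0$ is a completely $(X,I)$-nonmeasurable set.
   Context: A pair $(X,I)$ is a Polish ideal space if $X$ is an uncountable Polish space and $I\subseteq P(X)$ is a proper $\sigma$-ideal containing all at most countable subsets of $X$ and having a Borel base, i.e. every $A\in I$ is contained in some Borel set $B\subseteq X$ with $B\in I$. $B_+(I)$ denotes the family of all Borel subsets of $X$ that do not belong to $I$. For a family $\mathcal{A}$ of subsets of $X$ and $x\in X$, $\mathcal{A}_x=\{A\in\mathcal{A}: x\in A\}$. $\mathrm{cov}_h(\mathcal{A})=\min\{|\mathcal{B}|: \mathcal{B}\subseteq\mathcal{A}\text{ and there is } B\in B_+(I)\text{ with } B\subseteq\bigcup\mathcal{B}\}$. A set $A\subseteq X$ is completely $(X,I)$-nonmeasurable if for every $B\in B_+(I)$ both $A\cap B\neq\emptyset$ and $(X\setminus A)\cap B\neq\emptyset$. *)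

(* Defs.v *)
From mathcomp Require Import all_boot all_order all_algebra.
From mathcomp Require Import all_classical all_reals all_analysis.

Set Implicit Arguments.
Unset Strict Implicit.
Unset Printing Implicit Defensive.

Local Open Scope classical_set_scope.
Local Open Scope card_scope.

Definition separable (X : topologicalType) : Prop :=
  exists2 D : set X, countable D & dense D.

Definition homeomorphism (X Y : topologicalType) (f : X -> Y) : Prop :=
  continuous f /\ exists g : Y -> X, [/\ cancel f g, cancel g f & continuous g].

(* Completeness is written out as in the library's [cauchy_cvg], whose class
   additionally requires a distinguished point; for metric spaces it amounts to
   convergence of all Cauchy sequences. All real types are isomorphic, so the
   choice of [R] is immaterial. *)
Definition completely_metrizable (R : realType) (X : topologicalType) : Prop :=
  exists (M : metricType R) (f : X -> M),
    homeomorphism f /\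
    forall F : set_system M, ProperFilter F -> cauchy F -> exists l : M, F --> l.

Definition polish (R : realType) (X : topologicalType) : Prop :=
  separable X /\ completely_metrizable R X.

Definition Borel (X : topologicalType) : set (set X) := <<s @open X >>.

Record polish_ideal_space (R : realType) (X : topologicalType)
    (I : set (set X)) : Prop := PolishIdealSpace {
  pis_polish : polish R X ;
  pis_uncountable : ~ countable [set: X] ;
  pis_subset : forall A B : set X, A `<=` B -> I B -> I A ;
  pis_bigcup : forall F : nat -> set X, (forall n, I (F n)) ->
    I (\bigcup_n F n) ;
  pis_proper : ~ I [set: X] ;
  pis_countable : forall A : set X, countable A -> I A ;
  pis_Borel_base : forall A : set X, I A ->
    exists B : set X, [/\ Borel B, I B & A `<=` B]
}.

Definition Bplus (X : topologicalType) (I : set (set X)) : set (set X) :=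
  [set B | Borel B /\ ~ I B].

Definition family_at (X : Type) (A : set (set X)) (x : X) : set (set X) :=
  [set D | A D /\ D x].

Definition covh_families (X : topologicalType) (I A : set (set X)) :
    set (set (set X)) :=
  [set B | B `<=` A /\ exists2 C, Bplus I C & C `<=` \bigcup_(D in B) D].

(* Cardinals are represented by sets up to [#=]: [covh_is I A K] says that the
   minimum defining cov_h(A) exists and equals the cardinality of [K]. *)
Definition covh_is (X : topologicalType) (I A : set (set X))
    (U : Type) (K : set U) : Prop :=
  (exists2 B, covh_families I A B & B #= K) /\
  (forall B, covh_families I A B -> K #<= B).

Definition completely_nonmeasurable (X : topologicalType) (I : set (set X))
    (A : set X) : Prop :=
  forall B, Bplus I B -> A `&` B !=set0 /\ ~` A `&` B !=set0.

Definition continuum : set (set nat) := [set: set nat].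

(* Main.v *)
Require Import Defs.
From mathcomp Require Import all_boot all_order all_algebra.
From mathcomp Require Import all_classical all_reals all_analysis.
From mathcomp Require Import wochoice.
Import Order.TTheory GRing.Theory Num.Theory.

(** The theorem is proved by a transfinite induction of length continuum that
    handles the Borel sets outside [I] one after the other.  At the stage of
    such a set [B] two objects are chosen: a point [d] of [B], which is to stay
    outside the final union, and a member [D] of [A] that meets [B], which is
    to be part of the final union.  Two requirements link different stages: a
    new point avoids all the members chosen so far, and a new member avoids all
    the points chosen so far.

    Fewer than continuum many choices have been made before any given stage,
    and this is why it can be carried out.  By the hypothesis on [cov_h], fewer
    than continuum many members of [A] never cover [B], which yields [d].
    Since every point lies in a member of [A], this also shows that fewer than
    continuum many points never exhaust [B], which yields a point [x] of [B]
    different from [d] and from all earlier points [e].  Each [e] excludes only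
    countably many members of [A] containing [x], so all of them together
    exclude fewer than continuum many of the continuum many available ones, and
    some [D] is left.

    Three set-theoretic facts are behind this.
    - A union of fewer than continuum many countable sets has cardinality less
      than continuum ([small_bigcup_countable]).  It suffices that continuum is
      not a countable union of sets of smaller cardinality ([small_bigcup]),
      which is a diagonal argument of Koenig.
    - The stages can be well-ordered so that fewer than continuum many precede
      any given one ([small_initial_segments]).
    - There are at most continuum many Borel sets ([card_sigma_algebra] and
      [polish_second_countable]), because each of them is described by a
      well-founded tree labelled with open sets, of which a second countable
      space has at most continuum many ([second_countable_card_open]). *)

Local Open Scope classical_set_scope.
Local Open Scope card_scope.

(** * Sets of cardinality less than continuum *)

(** Cardinals being comparable, this says that [C] has cardinality less than
    continuum, in the form in which arguments by contradiction use it. *)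
Definition small {T : Type} (C : set T) : Prop := ~ (continuum #<= C).

Lemma small_le {T U : Type} (C : set T) (D : set U) :
  C #<= D -> small D -> small C.
Proof. by move=> CD sD cC; apply: sD; exact: card_le_trans cC CD. Qed.

(** Continuum has uncountable cofinality: view a set of naturals as a sequence
    of sets of naturals.  The [n]-th components coming from the small set [C n]
    miss some value [y n], so the sequence [y] comes from none of the [C n]. *)
Lemma small_bigcup {T : Type} (C : nat -> set T) :
  (forall n, small (C n)) -> small (\bigcup_n C n).
Proof.
move=> sC /pcard_surjP[g gC].
pose g_ (n : nat) x : set nat := [set k | g x (pickle (n, k))].
have /choice[y yP] n : exists s, ~ (g_ n @` C n) s.
  apply: contrapT => /forallNP gn; apply: (sC n).
  by apply/pcard_surjP; exists (g_ n) => s _; exact: contrapT (gn s).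
have [x [n _ Cx] gx] :=
  gC [set m | exists n k, m = pickle (n, k) /\ y n k] I.
apply: (yP n); exists x => //; apply/seteqP; rewrite /g_ gx; split=> [k|k] /=.
  by move=> [n' [k' [/(pcan_inj pickleK)[-> ->]]]].
by move=> ynk; exists n, k.
Qed.

(** Enumerating every [S e] turns the union into a countable union of images
    of [E], which [small_bigcup] covers. *)
Lemma small_bigcup_countable {T U : Type} (E : set T) (S : T -> set U) :
  small E -> (forall e, E e -> countable (S e)) -> small (\bigcup_(e in E) S e).
Proof.
move=> sE cS.
have /choice[h hP] e :
    exists h : nat -> option U, E e -> some @` S e `<=` range h.
  have [Ee|nEe] := pselect (E e); last first.
    by exists (fun=> None).
  by have /ocard_geP/surjPex[f fP] := cS _ Ee; exists f => _.
apply: (@small_le _ _ _ (\bigcup_n ((h ^~ n) @` E))); last first.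
  by apply: small_bigcup => n; exact: small_le (card_image_le _ _) sE.
rewrite -card_ge_some; apply: subset_card_le => _ [u [e Ee Seu] <-].
have [n _ hn] := hP e Ee (Some u) (imageP _ Seu).
by exists n => //; exists e.
Qed.

Lemma small_setU1 {T : Type} (E : set T) (x : T) : small E -> small (x |` E).
Proof.
move=> sE; have s1 : small [set x].
  (* one point cannot have both the empty and the full set as its image *)
  move=> /pcard_surjP[g g1].
  have [_ -> g0] := g1 set0 I; have [_ -> gT] := g1 setT I.
  by have : [set: nat] 0%N by []; rewrite -gT g0.
have -> : x |` E = \bigcup_n (if n is 0%N then [set x] else E).
  apply/seteqP; split=> [y [xy|Ey]|y [[|n] _]]; [by exists 0%N|by exists 1%N|..].
  - by left.
  - by right.
by apply: small_bigcup => -[].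
Qed.

(** * Well-orderings and transfinite choice *)

Lemma well_founded_min {T : Type} {lt : T -> T -> Prop} {C : set T} :
  well_founded lt -> C !=set0 -> exists2 m, C m & forall i, lt i m -> ~ C i.
Proof.
move=> wf [x Cx]; apply: contrapT => nm.
suff : forall x, ~ C x by move=> /(_ x).
by apply: (well_founded_ind wf) => m IH Cm; apply: nm; exists m.
Qed.

(** The well-ordering principle for the strict part of the order, in the form
    that supports recursion. *)
Lemma exists_well_founded_trichotomy (T : eqType) :
  exists lt : T -> T -> Prop,
    well_founded lt /\ forall i j, [\/ lt i j, i = j | lt j i].
Proof.
have [le wo] := well_ordering_principle T.
have minP (C : set T) : C !=set0 -> exists m,
    [/\ C m, forall i, C i -> le m i &
        forall z, C z -> (forall i, C i -> le z i) -> m = z].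
  move=> [x Cx]; have [|m [[/set_mem Cm mP] mu]] := wo (mem C).
    by exists x; apply/mem_set.
  exists m; split=> // [i Ci|z Cz zP]; first by apply: mP; exact/mem_set.
  by apply: mu; split=> [|i /set_mem/zP//]; exact/mem_set.
have refl i : le i i by have [_ [-> ->]] := minP [set i] (ex_intro _ i erefl).
exists (fun i j => ~~ le j i); split=> [x|i j].
  apply: contrapT => nx.
  have [z [nz zP _]] :=
    minP [set x | ~ Acc (fun i j => ~~ le j i) x] (ex_intro _ x nx).
  by apply: nz; constructor => y; apply: contraNP => /zP.
have [ij|] := boolP (le i j); last by move=> ?; apply: Or33.
have [ji|] := boolP (le j i); last by move=> ?; apply: Or31.
(* both [i] and [j] are the least element of the pair, which is unique *)
apply: Or32.
have [m [_ _ mu]] := minP [set i; j] (ex_intro _ i (or_introl erefl)).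
rewrite -(mu i) ?(mu j) //; try (by move=> k [] ->); by [left|right].
Qed.

(** If some initial segment of a well-ordering of the continuum has cardinality
    continuum, then the shortest one has only smaller initial segments and can
    replace the whole; this plays the part of the initial ordinal of the
    continuum. *)
Lemma small_initial_segments :
  exists (lt : set nat -> set nat -> Prop) (J : set (set nat)),
    [/\ well_founded lt, forall i j, [\/ lt i j, i = j | lt j i],
        continuum #<= J & forall j, J j -> small [set i | lt i j]].
Proof.
have [lt [wf tri]] := exists_well_founded_trichotomy (set nat).
exists lt; have [lL|] := pselect ([set k | ~ small [set i | lt i k]] !=set0).
  have [m /contrapT mL mP] := well_founded_min wf lL.
  by exists [set i | lt i m]; split=> // j /mP/contrapT.
move=> nL; exists setT; split=> // j _.
by apply: contrapT => jL; apply: nL; exists j.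
Qed.

(** Choices made by well-founded recursion, where [Q0 j] constrains the choice
    at stage [j] alone and [Q] relates it to each earlier one.  The hypothesis
    allows the earlier choices to be arbitrary, so whatever a step has to know
    about them must be built into [Q] as a premise. *)
Lemma transfinite_choice {T P : Type} (lt : T -> T -> Prop) (J : set T)
    (Q0 : T -> P -> Prop) (Q : P -> P -> Prop) :
  well_founded lt -> inhabited P ->
  (forall (F : T -> P) j, J j ->
     exists p, Q0 j p /\ forall i, lt i j -> Q (F i) p) ->
  exists F : T -> P, forall j, J j ->
    Q0 j (F j) /\ forall i, lt i j -> Q (F i) (F j).
Proof.
move=> wf [p0] step.
(* the values of [f] below [j], extended by a constant *)
pose ext j (f : forall i, lt i j -> P) i :=
  if pselect (lt i j) is left ij then f i ij else p0.
pose good j (f : forall i, lt i j -> P) p :=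
  J j -> Q0 j p /\ forall i, lt i j -> Q (ext j f i) p.
have goodP j f : {p | good j f p}.
  apply: cid; have [Jj|nJ] := pselect (J j); last by exists p0.
  by have [p Pp] := step (ext j f) _ Jj; exists p.
pose F := Fix wf (fun=> P) (fun j f => sval (goodP j f)).
have FE j : F j = sval (goodP j (fun i _ => F i)).
  rewrite /F Fix_eq // => k f g fg; congr (sval (goodP _ _)).
  apply: functional_extensionality_dep => i.
  exact: functional_extensionality_dep.
exists F => j Jj; rewrite FE; have [q0 q] := svalP (goodP j (fun i _ => F i)) Jj.
split=> // i ij; have := q i ij; rewrite /ext; by case: pselect.
Qed.

(** * The number of Borel sets *)

(** Codes for the sets of a generated sigma-algebra: leaves stand for
    generators, and nodes for complements of countable unions, an operation
    from which both complements and countable unions are recovered. *)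
Inductive code : Type :=
| leaf of set nat
| node of nat -> code.

Fixpoint decode {T : Type} (e : set nat -> set T) (c : code) : set T :=
  match c with
  | leaf s => e s
  | node f => ~` \bigcup_n decode e (f n)
  end.

(** A code is recovered from the positions and the labels of its leaves.  The
    pair [(p, 0)] records that the path [p] ends at a leaf, and [(p, k.+1)] that
    [k] belongs to the label of that leaf; without the former, a leaf with
    empty label would leave no trace. *)
Fixpoint address (c : code) : set (seq nat * nat) :=
  match c with
  | leaf s => [set pk | pk.1 = [::] /\ if pk.2 is k.+1 then s k else True]
  | node f => [set pk | if pk.1 is n :: p then address (f n) (p, pk.2) else False]
  end.

Lemma address_inj : injective address.
Proof.
elim=> [s|f IH] [t|g] E.
- congr leaf; apply/seteqP; split=> k sk.
    by have : address (leaf s) ([::], k.+1) by []; rewrite E => -[].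
  by have : address (leaf t) ([::], k.+1) by []; rewrite -E => -[].
- by have : address (leaf s) ([::], 0%N) by []; rewrite E.
- by have : address (leaf t) ([::], 0%N) by []; rewrite -E.
- congr node; apply: funext => n; apply: IH; apply/seteqP; split=> -[p k] pk.
    by have : address (node f) (n :: p, k) by []; rewrite E.
  by have : address (node g) (n :: p, k) by []; rewrite -E.
Qed.

(** A set of pairs of a path and a label amounts to a set of naturals. *)
Lemma card_code : [set: code] #<= continuum.
Proof.
apply/pcard_injP; exists (fun c => pickle @` address c) => c d _ _ E.
have pI : injective (@pickle (seq nat * nat)%type) := pcan_inj pickleK.
by apply/address_inj/funext => x; rewrite -(image_inj pI) E image_inj.
Qed.

(** The sets that have a code form a sigma-algebra containing [G], and
    [card_code] bounds the number of codes. *)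
Lemma card_sigma_algebra {T : Type} (G : set (set T)) :
  G #<= continuum -> <<s G >> #<= continuum.
Proof.
move=> /pcard_surjP[e eG].
apply: card_le_trans card_code.
apply: card_le_trans (card_image_le (decode e) _).
apply: subset_card_le; apply: smallest_sub; last first.
  by move=> A /eG[s _ <-]; exists (leaf s).
have nodeP (F : nat -> set T) : (forall n, range (decode e) (F n)) ->
    range (decode e) (~` \bigcup_n F n).
  move=> /(_ _)/cid2-/all_sig[f fP].
  exists (node f) => //=; congr (~` _); apply: eq_bigcupr => n _.
  by have [_ ->] := fP n.
have setCP (A : set T) : range (decode e) A -> range (decode e) (~` A).
  by move=> rA; rewrite -(bigcup_const (P := [set: nat]) A) //; exact: nodeP.
have UP (F : nat -> set T) : (forall n, range (decode e) (F n)) ->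
    range (decode e) (\bigcup_n F n).
  by move=> rF; rewrite -[X in range _ X]setCK; exact/setCP/nodeP.
split=> [|A|]; [|by rewrite setTD; exact: setCP|exact: UP].
(* the empty set is the complement of the union of a set and its complement *)
pose F n : set T := if n is 0%N then e set0 else ~` e set0.
have F0 : (~` \bigcup_n F n) = set0.
  rewrite -subset0 => x nx; apply: nx.
  by have [|] := pselect (e set0 x); [exists 0%N|exists 1%N].
rewrite -F0; apply: nodeP => -[|n]; [|apply: setCP]; by exists (leaf set0).
Qed.

(** A base is given by the balls of radius [1 / (n + 1)] around the points of a
    countable dense set, pulled back along the homeomorphism. *)
Lemma polish_second_countable (R : realType) (X : topologicalType) :
  polish R X -> @second_countable X.
Proof.
move=> [[D cD dD] [M [f [[fc [g [fg gf gc]]] _]]]].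
have posV n : (0 < n.+1%:R^-1 :> R)%R by [].
(* interiors, because balls are not open by definition *)
pose V (dn : X * nat) : set X :=
  f @^-1` (ball (f dn.1) (PosNum (posV dn.2))%:num)°%R.
have oV dn : open (V dn).
  by apply: open_comp; [move=> ? _; exact: fc|exact: open_interior].
exists (V @` (D `*` [set: nat])); [|split].
- apply: card_le_trans (card_image_le _ _) _; exact: countableX.
- by move=> _ [dn _ <-].
- move=> x U xU.
  have : nbhs (f x) (g @^-1` U) by apply: gc; rewrite fg.
  move=> /nbhs_ballP[_/posnumP[eps] epsU].
  have [|n] := @ltr_add_invr R 0%R (eps%:num / 2)%R _; first by [].
  rewrite add0r => neps.
  pose r := PosNum (posV n).
  (* Half the radius of the basic set: then the ball of radius [r] around [f d]
     contains a neighbourhood of [f x], and [x] is in the interior. *)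
  have [||d [/= dx Dd]] := dD (f @^-1` (ball (f x) (r%:num / 2))°%R).
  - by exists x; exact: nbhsx_ballx.
  - by apply: open_comp; [move=> ? _; exact: fc|exact: open_interior].
  have /ball_sym xd := interior_subset dx.
  exists (V (d, n)); first split; first by exists (d, n).
    rewrite /V /=; apply: filterS (nbhsx_ballx (f x) (r%:num / 2)%R _) => // y xy.
    by rewrite [_%:num%R]splitr; exact: ball_triangle xd xy.
  move=> y /interior_subset dy; rewrite -(fg y); apply: epsU.
  rewrite [_%:num%R]splitr; apply: (@ball_triangle _ _ (f d)).
    apply: le_ball (ball_sym xd); apply: ltW; apply: le_lt_trans neps.
    by rewrite ler_pdivrMr // ler_peMr // ler1n.
  exact: le_ball (ltW neps) _ dy.
Qed.

(** An open set is the union of the basic sets that it contains. *)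
Lemma second_countable_card_open (X : topologicalType) :
  @second_countable X -> @open X #<= continuum.
Proof.
move=> [B cB [oB Bb]].
have /pcard_surjP[e eB] := cB.
apply: card_le_trans (card_image_le (fun s : set nat => \bigcup_(n in s) e n) _).
apply: subset_card_le => U oU; exists [set n | e n `<=` U] => //.
apply/seteqP; split=> [x [n /= nU /nU //]|x Ux].
have [V [BV Vx] VU] := Bb x U (open_nbhs_nbhs (conj oU Ux)).
by have [n _ nV] := eB V BV; exists n; rewrite /= nV.
Qed.

(** * The construction of the subfamily *)

Theorem theorem2p1 (R : realType) (X : topologicalType) (I : set (set X))
    (hXI : polish_ideal_space R I)
    (A : set (set X)) (hAI : A `<=` I)
    (h1 : forall x : X, family_at A x #= continuum)
    (h2 : forall x y : X, x <> y ->
      countable (family_at A x `&` family_at A y))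
    (h3 : covh_is I A continuum) :
  exists A0 : set (set X), A0 `<=` A /\
    completely_nonmeasurable I (\bigcup_(D in A0) D).
Proof.
have [_ covA] := h3.
have no_cover (F : set (set X)) B : F `<=` A -> small F -> Bplus I B ->
    exists2 x, B x & forall D, F D -> ~ D x.
  move=> FA sF BB; apply: contrapT => nx; apply/sF/covA; split=> //.
  exists B => // x Bx; apply: contrapT => xF; apply: nx; exists x => // D FD Dx.
  by apply: xF; exists D.
have family_at_neq0 (x : X) : family_at A x !=set0.
  apply/set0P/eqP => Ax0.
  have := h1 x; rewrite Ax0 card_eq_sym card_eq0; apply/negP.
  by apply/set0P; exists set0.
have [x0 _] : [set: X] !=set0.
  by apply/set0P/eqP => X0; apply: (pis_uncountable hXI); rewrite X0.
have cB : Bplus I #<= continuum.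
  apply: card_le_trans (card_sigma_algebra (@open X) _); last first.
    exact/second_countable_card_open/polish_second_countable/(pis_polish hXI).
  by apply: subset_card_le => B [].
have [lt [J [wf tri cJ sJ]]] := small_initial_segments.
have /pcard_surjP[B BP] := card_le_trans cB cJ.
(* [F j] is the pair of the point kept out and the member put in at stage [j];
   the premise [A q.2] of the linking condition makes up for the recursion not
   guaranteeing that earlier choices are members of [A]. *)
have [||F FP] := @transfinite_choice _ (X * set X)%type lt
    (J `&` [set j | Bplus I (B j)])
    (fun j p => [/\ A p.2, p.2 `&` B j !=set0, B j p.1 & ~ p.2 p.1])
    (fun q p => (A q.2 -> ~ q.2 p.1) /\ ~ p.2 q.1) wf.
- by constructor; exact: (x0, set0).
- move=> F j [Jj Bj].
  have [d Bd dP] : exists2 d, B j d &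
      forall D, (A `&` [set (F i).2 | i in [set i | lt i j]]) D -> ~ D d.
    apply: no_cover => //.
    apply: small_le (sJ j Jj); apply: card_le_trans (card_image_le (snd \o F) _).
    by apply: subset_card_le => D [].
  (* the points that the new member must avoid, including the new one *)
  pose E := d |` [set (F i).1 | i in [set i | lt i j]].
  have sE : small E by apply/small_setU1/(small_le _ _ (card_image_le _ _))/sJ.
  have /choice[g gP] := family_at_neq0.
  (* if [E] exhausted [B j], one member of [A] for each of its points would
     cover [B j] *)
  have [x Bx xP] : exists2 x, B j x & forall D, (g @` E) D -> ~ D x.
    apply: no_cover => //; first by move=> _ [e _ <-]; have [] := gP e.
    exact: small_le (card_image_le _ _) sE.
  have xE e : E e -> x <> e.
    by move=> Ee xe; apply: (xP (g e)); [exists e|rewrite xe; have [] := gP e].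
  have sS := small_bigcup_countable _ _ sE (fun e Ee => h2 _ _ (xE e Ee)).
  have [D [AD Dx] DP] : exists2 D, family_at A x D & forall e, E e -> ~ D e.
    apply: contrapT => nD; apply: sS; have /card_eqPle[_ cAx] := h1 x.
    apply: card_le_trans cAx _; apply: subset_card_le => D [AD Dx].
    apply: contrapT => De; apply: nD; exists D => // e Ee De'.
    by apply: De; exists e.
  exists (d, D); split=> /=.
    by split=> //; [exists x|apply: DP; left].
  move=> i ij; split=> [AFi|]; first by apply: dP; split=> //; exists i.
  by apply: DP; right; exists i.
exists [set (F j).2 | j in J `&` [set j | Bplus I (B j)]]; split.
  by move=> _ [j Jj <-]; have [[]] := FP j Jj.
move=> C BC; have [j Jj jC] := BP C BC.
have [[AD [x [Dx Bx]] Bd Dd] jP] : _ := FP j (conj Jj (eq_ind_r _ BC jC)).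
rewrite jC in Bx Bd; split.
  exists x; split=> //; exists (F j).2 => //; exists j => //.
  by split=> //=; rewrite jC.
exists (F j).1; split=> // -[_ [i [Ji Bi] <-] Did].
have [[AFi _ _ _] iP] := FP i (conj Ji Bi).
have [ij|ij|ji] := tri i j.
- by have [/(_ AFi)] := jP i ij.
- by apply: Dd; rewrite -ij in Did *.
- by have [_] := iP j ji.
Qed.
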